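(* An $n$th-order time-marching finite-difference scheme of the form $$u(x,\Delta t)=\sum_{i=1}^N c_i\, u(x+k_i\Delta x,0)$$ for solving the equation $$\frac{\partial u}{\partial t}=a_m\,\partial_x^m u,$$ where $a_m$ is a real constant and $m$ a whole number $\ge 1$, must have a minimum of $N=nm+1$ grid points. The latter is any set of $N$ integers $\{k_i\}$ clustered around zero.
   Context: Here $\Delta t$ is the time step, $\Delta x$ is the grid spacing, $\{k_i\}$ is a set of $N$ integers clustered around zero (usually $N$ consecutive integers containing zero, but not specified in advance), which label the grid points $x+k_i\Delta x$, and $\{c_i\}$ is a set of coefficients. The exact solution of the equation is written formally as $u(x,\Delta t)=e^{\Delta t\,a_m\partial_x^m}u(x,0)$, and each grid value as $u(x+k_i\Delta x,0)=e^{k_i\Delta x\,\partial_x}u(x,0)$. For a given set $\{k_i\}$, the coefficients $c_i$ are determined by Taylor expanding both sides of the operator equality $$e^{\Delta t\,a_m\partial_x^m}=\sum_{i=1}^N c_i\,e^{k_i\Delta x\,\partial_x}$$ and matching powers of $\partial_x$. The scheme is an $n$th-order time-marching scheme when the two sides match in all powers of $\partial_x$ from the zeroth up to and including the $(nm)$th; this gives $nm+1$ linear order conditions on $\{c_i\}$.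
   Formalization: The minimum N ≥ nm+1 is stated for a_m ≠ 0 and for coefficients c_i depending on Δt whose order conditions hold for all sufficiently small Δt at fixed Δx; it fails for a_m = 0 (k={0}, c=1) and at isolated time steps (m=1, a_mΔt=Δx, k={1}, c=1). *)

(* Defs.v *)
From mathcomp Require Import all_boot all_order all_algebra.
From mathcomp Require Import reals.
Set Implicit Arguments.
Unset Strict Implicit.
Unset Printing Implicit Defensive.

Import Order.TTheory GRing.Theory Num.Theory.
Local Open Scope ring_scope.

(* Differential operators with constant coefficients are represented by their
   symbols: 'X stands for d/dx.  [exp_coef p j] is the coefficient of 'X^j in
   the formal power series exp p = \sum_l p^l / l!.  It is meant for p without
   constant term: then p^l has no term of degree < l, so that the terms l > j,
   left out of the finite sum below, do not contribute. *)
Definition exp_coef (R : realType) (p : {poly R}) (j : nat) : R :=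
  \sum_(l < j.+1) (p ^+ l)`_j / l`!%:R.

(* Matching of the powers 0, ..., n * m of d/dx in
     exp (dt a (d/dx)^m) = \sum_i c_i exp (k_i dx (d/dx)),
   where exp (dt a (d/dx)^m) is the exact evolution of u_t = a (d/dx)^m u over
   the time dt and exp (k_i dx (d/dx)) is the shift u(x) |-> u(x + k_i dx). *)
Definition order_conditions (R : realType) (n m : nat) (a dt dx : R) (N : nat)
    (k : 'I_N -> int) (c : 'I_N -> R) : Prop :=
  forall j : nat, (j <= n * m)%N ->
    exp_coef ((dt * a) *: 'X^m) j =
    \sum_(i < N) c i * exp_coef (((k i)%:~R * dx) *: 'X) j.

(* The coefficients are functions of the time step, and the order conditions
   are required for all time steps in ]0, tau[.  At an isolated time step they
   may be solvable on a smaller grid: for m = 2, n = 1, a dt = dx^2 / 2, the two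
   points -1, 1 suffice, and for m = 1, a dt = dx, the single point 1. *)
Definition time_marching_scheme (R : realType) (n m : nat) (a dx tau : R)
    (N : nat) (k : 'I_N -> int) (c : R -> 'I_N -> R) : Prop :=
  forall dt : R, 0 < dt -> dt < tau -> order_conditions n m a dt dx k (c dt).

(* Main.v *)
Require Import Defs.
From mathcomp Require Import all_boot all_order all_algebra.
From mathcomp Require Import reals.
From mathcomp Require Import ring.
Set Implicit Arguments.
Unset Strict Implicit.
Unset Printing Implicit Defensive.

Import Order.TTheory GRing.Theory Num.Theory.
Local Open Scope ring_scope.

(** The order conditions prescribe the moments [\sum_i c_i x_i ^+ j],
    [j <= n * m], where [x_i = k_i * dx].  On [n * m + 1] distinct points this
    is a Vandermonde system.  On [N <= n * m] points, the monic polynomial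
    [q = 'X^(n * m - N) * \prod_i ('X - x_i)] vanishes at the [x_i], so the
    combination of the moments with the coefficients of [q] is [0].  By the
    order conditions this combination is a polynomial in [dt] whose coefficient
    of degree [n] is [(n * m)! / n! * a ^+ n != 0]; it can therefore not vanish
    for all small time steps. *)

(** The [l]-th power is [b ^+ l *: 'X^(m * l)], so only the term with [m * l = j] contributes; as
    [0 < m], this [l] is unique and at most [j], hence within the truncated sum. *)
Lemma exp_coef_scaleXn (R : realType) (m : nat) (b : R) (j : nat) :
  (0 < m)%N ->
  exp_coef (b *: 'X^m) j =
  if (m %| j)%N then b ^+ (j %/ m) / (j %/ m)`!%:R else 0.
Proof.
move=> m_gt0; rewrite /exp_coef.
under eq_bigr => l _ do rewrite exprZn -exprM coefZ coefXn.
case: ifP => [/dvdnP [l ->]|ndv].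
  rewrite mulnK // [(l * m)%N]mulnC.
  have lt_l : (l < (m * l).+1)%N by rewrite ltnS leq_pmull.
  rewrite (bigD1 (Ordinal lt_l)) //= eqxx mulr1 big1 ?addr0 // => i ne_il.
  rewrite eqn_pmul2l // eq_sym; case: eqP => [eq_il|]; last by rewrite mulr0 mul0r.
  by case/eqP: ne_il; apply: val_inj.
apply: big1 => i _; case: eqP => [eq_j|]; last by rewrite mulr0 mul0r.
by rewrite eq_j dvdn_mulr in ndv.
Qed.

Lemma exp_coef_scaleX (R : realType) (b : R) (j : nat) :
  exp_coef (b *: 'X) j = b ^+ j / j`!%:R.
Proof. by rewrite -['X]expr1 exp_coef_scaleXn // dvd1n divn1. Qed.

Lemma natr_fact_neq0 (R : numDomainType) (n : nat) : n`!%:R != 0 :> R.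
Proof. by rewrite pnatr_eq0 -lt0n fact_gt0. Qed.

(** Multiplying the [j]-th condition by [j!] clears the denominator of the shift operators. *)
Lemma order_conditions_moments (R : realType) (n m : nat) (a dt dx : R)
    (N : nat) (k : 'I_N -> int) (c : 'I_N -> R) :
  order_conditions n m a dt dx k c <->
  forall j : nat, (j <= n * m)%N ->
    \sum_(i < N) c i * ((k i)%:~R * dx) ^+ j =
    j`!%:R * exp_coef ((dt * a) *: 'X^m) j.
Proof.
have sumE j : \sum_(i < N) c i * exp_coef (((k i)%:~R * dx) *: 'X) j =
    (\sum_(i < N) c i * ((k i)%:~R * dx) ^+ j) / j`!%:R.
  by rewrite mulr_suml; apply: eq_bigr => i _; rewrite exp_coef_scaleX mulrA.
split=> H j le_j; have := H j le_j; rewrite sumE => Hj.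
  by rewrite Hj mulrC divfK // natr_fact_neq0.
by rewrite Hj mulrAC divff ?mul1r // natr_fact_neq0.
Qed.

Lemma poly_eq0_itv (R : realFieldType) (p : {poly R}) (tau : R) :
  0 < tau -> (forall t, 0 < t -> t < tau -> p.[t] = 0) -> p = 0.
Proof.
(* These are [size p] distinct roots, more than the degree allows; denominators start at 2 to stay
   strictly below [tau]. *)
move=> tau_gt0 p0; pose rs := [seq tau / i.+2%:R | i <- iota 0 (size p)].
apply: (@roots_geq_poly_eq0 _ p rs); last by rewrite size_map size_iota.
  apply/allP => _ /mapP [i _ ->]; apply/eqP/p0; first by rewrite divr_gt0.
  by rewrite ltr_pdivrMr // ltr_pMr // ltr1n.
rewrite map_inj_uniq ?iota_uniq // => i j /(mulfI (lt0r_neq0 tau_gt0)).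
by move/invr_inj/eqP; rewrite eqr_nat => /eqP [].
Qed.

Lemma Vandermonde_unit (F : fieldType) (n : nat) (x : 'rV[F]_n) :
  injective (x 0) -> Vandermonde n x \in unitmx.
Proof.
move=> x_inj; rewrite unitmxE det_Vandermonde unitfE.
apply/prodf_neq0 => i _; apply/prodf_neq0 => j lt_ij.
by rewrite subr_eq0 (inj_eq x_inj) -val_eqE gtn_eqF.
Qed.

(** The matrix of the system is an invertible Vandermonde matrix. Taking [c] in a [ffun] type lets
    uniqueness be a plain equality, proved pointwise. *)
Lemma moment_problem_unique (F : fieldType) (n : nat) (x : 'I_n -> F)
    (b : nat -> F) :
  injective x ->
  exists! c : {ffun 'I_n -> F},
    forall j : nat, (j < n)%N -> \sum_(i < n) c i * x i ^+ j = b j.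
Proof.
move=> x_inj; pose V := Vandermonde n (\row_i x i).
have V_unit : V \in unitmx.
  by apply: Vandermonde_unit => i j; rewrite !mxE => /x_inj.
have VE (c : 'cV[F]_n) (j : 'I_n) :
    (V *m c) j 0 = \sum_(i < n) c i 0 * x i ^+ j.
  by rewrite mxE; apply: eq_bigr => i _; rewrite !mxE mulrC.
pose s := invmx V *m (\col_j b j).
exists [ffun i => s i 0]; split=> [j lt_j|c c_sol].
  under eq_bigr do rewrite ffunE.
  by rewrite -(VE s (Ordinal lt_j)) /s mulKVmx // mxE.
have -> : s = \col_i c i.
  rewrite /s -[RHS](mulKmx V_unit); congr (_ *m _).
  apply/colP => j; rewrite VE mxE -c_sol //.
  by apply: eq_bigr => i _; rewrite mxE.
by apply/ffunP => i; rewrite ffunE mxE.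
Qed.

Lemma scheme_grid_size (R : realType) (n m : nat) (a dx tau : R) (N : nat)
    (k : 'I_N -> int) (c : R -> 'I_N -> R) :
  (0 < m)%N -> a != 0 -> 0 < tau ->
  time_marching_scheme n m a dx tau k c -> (n * m < N)%N.
Proof.
move=> m_gt0 a_neq0 tau_gt0 c_scheme; rewrite ltnNge; apply/negP => le_N.
pose x i := (k i)%:~R * dx.
(* The power of ['X] raises the degree to exactly [n * m], so that the highest moment enters with
   coefficient 1. *)
pose q := 'X^(n * m - N) * \prod_(i < N) ('X - (x i)%:P).
have q_monic : q \is monic by rewrite monicMl ?monicXn ?monic_prod_XsubC.
have size_q : size q = (n * m).+1.
  rewrite size_monicM ?monicXn ?monic_neq0 ?monic_prod_XsubC //.
  by rewrite size_polyXn size_prod_XsubC /index_enum -enumT size_enum_ord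
             addnS /= addSn subnK.
have q_top : q`_(n * m) = 1 by move/monicP: q_monic; rewrite /lead_coef size_q.
have q_root i : q.[x i] = 0.
  by rewrite hornerM horner_prod (bigD1 i) //= hornerXsubC subrr mul0r mulr0.
(* The combination of the prescribed moments with the coefficients of [q], with [dt] as the
   indeterminate. *)
pose P := \sum_(j < (n * m).+1 | (m %| j)%N)
  (q`_j * j`!%:R / (j %/ m)`!%:R * a ^+ (j %/ m)) *: 'X^(j %/ m).
have P0 : P = 0.
  apply: (poly_eq0_itv tau_gt0) => dt dt_gt0 dt_lt.
  have /order_conditions_moments moments := c_scheme dt dt_gt0 dt_lt.
  have -> : P.[dt] = \sum_(j < (n * m).+1) q`_j * \sum_(i < N) c dt i * x i ^+ j.
    rewrite horner_sum big_mkcond; apply: eq_bigr => j _.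
    rewrite moments -1?ltnS // exp_coef_scaleXn //.
    case: ifP => _; last by rewrite !mulr0.
    by rewrite hornerZ hornerXn exprMn; ring.
  (* Summing over [j] first turns the combination into the sum of the [c dt i * q.[x i]]. *)
  under eq_bigr do rewrite mulr_sumr.
  rewrite exchange_big big1 // => i _.
  transitivity (c dt i * q.[x i]); last by rewrite q_root mulr0.
  rewrite horner_coef size_q mulr_sumr.
  by apply: eq_bigr => j _; rewrite mulrCA.
(* Degree [n] arises only from [j = n * m], the index [ord_max]. *)
have : P`_n = (n * m)`!%:R / n`!%:R * a ^+ n.
  rewrite coef_sum (bigD1 ord_max) /= ?dvdn_mull // mulnK //.
  rewrite coefZ coefXn eqxx mulr1 q_top mul1r big1 ?addr0 // => j.
  case/andP=> /dvdnP [l j_eq] ne_j; rewrite coefZ coefXn j_eq mulnK //.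
  case: eqP => [n_eq|]; last by rewrite mulr0.
  by case/eqP: ne_j; apply: val_inj; rewrite /= j_eq n_eq.
rewrite P0 coef0 => /esym/eqP; apply/negP.
by rewrite !mulf_neq0 ?invr_neq0 ?natr_fact_neq0 ?expf_neq0.
Qed.

Theorem theorem1 (R : realType) (n m : nat) (hm : (1 <= m)%N) (a : R) :
  (a != 0 ->
   forall (N : nat) (k : 'I_N -> int), injective k ->
   forall (dx tau : R), 0 < dx -> 0 < tau ->
   forall c : R -> 'I_N -> R,
     time_marching_scheme n m a dx tau k c -> (n * m + 1 <= N)%N)
  /\
  (forall k : 'I_(n * m + 1) -> int, injective k ->
   forall dt dx : R, 0 < dt -> 0 < dx ->
   exists! c : {ffun 'I_(n * m + 1) -> R}, order_conditions n m a dt dx k c).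
Proof.
split=> [a_neq0 N k _ dx tau _ tau_gt0 c|k k_inj dt dx _ dx_gt0].
  by rewrite addn1; apply: scheme_grid_size.
have x_inj : injective (fun i => (k i)%:~R * dx : R).
  by move=> i j /(mulIf (lt0r_neq0 dx_gt0)) /intr_inj /k_inj.
have [c [c_sol c_uniq]] :=
  moment_problem_unique (fun j => j`!%:R * exp_coef ((dt * a) *: 'X^m) j) x_inj.
exists c; split=> [|c' /order_conditions_moments c'_sol].
  by apply/order_conditions_moments => j le_j; apply: c_sol; rewrite addn1.
by apply: c_uniq => j lt_j; apply: c'_sol; rewrite addn1 ltnS in lt_j.
Qed.
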